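(* Let $G$ be a (not necessarily abelian) group, let $X=P_n$ be a path graph with vertices $v_0,\dots,v_{n-1}$, $n\ge 2$, and let $A=\{v_0,v_{n-1}\}$ be its set of endpoints. Let $\mathcal{G}_A$ be the subsheaf of groups of the constant sheaf $\underline{G}$ with trivial stalks at the vertices of $A$ and stalk $G$ elsewhere, let $\mathcal{Q}=\underline{G}/\mathcal{G}_A$, so that $H^0(X;\mathcal{Q})\cong G\times G$, and let $\delta^*:H^0(X;\mathcal{Q})\to H^1(X;\mathcal{G}_A)$ be the connecting map. Then for boundary data $\beta=(g_0,g_1)\in G\times G$, the class $\delta^*(\beta)$ is the distinguished element of $H^1(X;\mathcal{G}_A)$ if and only if $g_0=g_1$. In particular, if $g_0\ne g_1$ then the obstruction class $\delta^*(\beta)\in H^1(X;\mathcal{G}_A)$ is non-trivial.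
   Context: A network sheaf of groups $\mathcal{F}$ on an oriented graph $X=(V,E)$ assigns groups $\mathcal{F}(v)$, $\mathcal{F}(e)$ to vertices and edges and homomorphisms $\mathcal{F}_{v\to e}:\mathcal{F}(v)\to\mathcal{F}(e)$ to incidences. The constant sheaf $\underline{G}$ has all stalks $G$ and all restriction maps the identity. The sheaf $\mathcal{G}_A$ has stalk $\{1\}$ on vertices in $A$, stalk $G$ on all other vertices and on all edges, and restriction maps the inclusions into $G$. The quotient $\mathcal{Q}$ has stalk $G$ at vertices of $A$ and a one-point stalk at all other vertices and edges; an element of $H^0(X;\mathcal{Q})$ is an assignment $\beta=(g_0,g_1)$ of elements of $G$ to $v_0$ and $v_{n-1}$ respectively. $H^1(X;\mathcal{F})$ is the pointed set of families $\eta=(\eta_e)_{e\in E}$, $\eta_e\in\mathcal{F}(e)$, modulo $\eta\sim\eta'$ iff there exist $\xi_v\in\mathcal{F}(v)$ with $\eta'_e=\mathcal{F}_{u\to e}(\xi_u)^{-1}\,\eta_e\,\mathcal{F}_{v\to e}(\xi_v)$ for every oriented edge $e=(u,v)$; its distinguished element is the class of the identity family. The connecting map $\delta^*$ of the short exact sequence $1\to\mathcal{G}_A\to\underline{G}\to\mathcal{Q}\to1$ sends $\beta=(g_0,g_1)$ to the class in $H^1(X;\mathcal{G}_A)$ of $\eta_e=\xi_u^{-1}\xi_v$ ($e=(u,v)$), where $(\xi_v)_{v\in V}$ is any family in $G$ with $\xi_{v_0}=g_0$ and $\xi_{v_{n-1}}=g_1$; this class is independent of the choice of $\xi$. *)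

(* Defs.v *)
From HB Require Import structures.
From mathcomp Require Import all_boot.
From mathcomp Require Import boolp.

Set Implicit Arguments.
Unset Strict Implicit.
Unset Printing Implicit Defensive.

Local Open Scope group_scope.
Local Open Scope quotient_scope.

(* A group homomorphism: the library's unital multiplicative map. *)
Notation "{ 'grouphom' G -> H }" := (UMagmaMorphism.type G%type H%type)
  (at level 0, G at level 98, H at level 99) : type_scope.

Record ograph := OGraph {
  vert : finType;
  edge : finType;
  tail : edge -> vert;
  head : edge -> vert }.

(* Restriction maps are indexed by incidences: each edge [e = (tail e, head e)]
   carries one from each of its two ends. *)
Record group_sheaf (X : ograph) := GroupSheaf {
  vstalk : vert X -> groupType;
  estalk : edge X -> groupType;
  res_tail : forall e, {grouphom vstalk (tail e) -> estalk e};
  res_head : forall e, {grouphom vstalk (head e) -> estalk e} }.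

(* Network sheaves of sets; the quotient of a sheaf of groups by a subsheaf
   that is not normal is only of this kind. *)
Record set_sheaf (X : ograph) := SetSheaf {
  svstalk : vert X -> choiceType;
  sestalk : edge X -> choiceType;
  sres_tail : forall e, svstalk (tail e) -> sestalk e;
  sres_head : forall e, svstalk (head e) -> sestalk e }.
Arguments sres_tail {X} s e _.
Arguments sres_head {X} s e _.

Definition H0 (X : ograph) (Q : set_sheaf X) : Type :=
  {s : {dffun forall v, svstalk Q v}
     | [forall e, sres_tail Q e (s (tail e)) == sres_head Q e (s (head e))]}.

Section H1.
Variables (X : ograph) (F : group_sheaf X).

Definition cochain1 : choiceType := {dffun forall e, estalk F e}.

Definition cohomologous (eta eta' : cochain1) : Prop :=
  exists xi : forall v, vstalk F v, forall e,
    eta' e = (res_tail F e (xi (tail e)))^-1 * eta e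
             * res_head F e (xi (head e)).

Definition cohomologousb : rel cochain1 :=
  fun eta eta' => `[< cohomologous eta eta' >].

Lemma cohomologousb_refl : reflexive cohomologousb.
Proof.
move=> eta; apply/asboolP; exists (fun=> 1) => e.
by rewrite !gmulf1 invg1 mul1g mulg1.
Qed.

Lemma cohomologousb_sym : symmetric cohomologousb.
Proof.
suff H eta eta' : cohomologous eta eta' -> cohomologous eta' eta.
  by move=> eta eta'; apply/asboolP/asboolP; apply: H.
case=> xi xiE; exists (fun v => (xi v)^-1) => e.
by rewrite xiE !gmulfV invgK -!mulgA mulgV mulg1 mulVKg.
Qed.

Lemma cohomologousb_trans : transitive cohomologousb.
Proof.
move=> eta2 eta1 eta3 /asboolP[xi xiE] /asboolP[zeta zetaE].
apply/asboolP; exists (fun v => xi v * zeta v) => e.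
by rewrite zetaE xiE !gmulfM invgM !mulgA.
Qed.

Canonical cohomologousb_equiv :=
  EquivRel cohomologousb
    cohomologousb_refl cohomologousb_sym cohomologousb_trans.

Definition H1 : Type := {eq_quot cohomologousb}.

Definition H1_class (eta : cochain1) : H1 :=
  \pi_({eq_quot cohomologousb}) eta.

Lemma H1_classP (eta eta' : cochain1) :
  H1_class eta = H1_class eta' <-> cohomologous eta eta'.
Proof. by split=> [/eqmodP/asboolP | ?]; last by apply/eqmodP/asboolP. Qed.

Definition H1_one : H1 := H1_class [ffun e => 1].

End H1.

Section Subgroup.
Variables (G : groupType) (S : groupClosed G).

Record subgroup_of := SubgroupOf { sgval : G; _ : sgval \in S }.

HB.instance Definition _ := [isSub for sgval].
HB.instance Definition _ := [Choice of subgroup_of by <:].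

Fact subgroup_closed : group_closed (fun x => x \in S).
Proof. by split=> [|x y xS yS]; [exact: gpred1 | exact: gpredF]. Qed.

HB.instance Definition _ :=
  SubChoice_isSubGroup.Build G (fun x => x \in S) subgroup_of subgroup_closed.

(* Left cosets [x S], matching the action of vertex families in [H1]. *)
Definition lcoset_rel : rel G := fun x y => x^-1 * y \in S.

Lemma lcoset_rel_refl : reflexive lcoset_rel.
Proof. by move=> x; rewrite /lcoset_rel mulVg gpred1. Qed.

Lemma lcoset_rel_sym : symmetric lcoset_rel.
Proof. by move=> x y; rewrite /lcoset_rel -gpredV invgM invgK. Qed.

Lemma lcoset_rel_trans : transitive lcoset_rel.
Proof.
move=> y x z xy yz; rewrite /lcoset_rel -(mulVKg y z) mulgA.
exact: gpredM.
Qed.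

Canonical lcoset_rel_equiv :=
  EquivRel lcoset_rel lcoset_rel_refl lcoset_rel_sym lcoset_rel_trans.

Definition lcoset_of : choiceType := {eq_quot lcoset_rel}.

Definition lcoset_class (x : G) : lcoset_of := \pi_({eq_quot lcoset_rel}) x.

Definition lcoset_repr (c : lcoset_of) : G := repr (c : {eq_quot lcoset_rel}).

Lemma lcoset_classP x y : reflect (lcoset_class x = lcoset_class y)
  (x^-1 * y \in S).
Proof.
change (reflect (x = y %[mod {eq_quot lcoset_rel}]) (lcoset_rel x y)).
exact: eqmodP.
Qed.

Lemma lcoset_reprK : cancel lcoset_repr lcoset_class.
Proof. exact: reprK. Qed.

End Subgroup.

Section SubgroupHom.
Variables (G H : groupType) (f : {grouphom G -> H}).
Variables (S : groupClosed G) (T : groupClosed H).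
Hypothesis fST : {homo f : x / x \in S >-> x \in T}.

Definition sub_res (x : subgroup_of S) : subgroup_of T :=
  SubgroupOf (fST (valP x)).

Fact sub_res_morph : monoid_morphism sub_res.
Proof.
split=> [|x y]; apply: val_inj; first by rewrite /= gmulf1.
by rewrite /= gmulfM.
Qed.

HB.instance Definition _ :=
  isUMagmaMorphism.Build _ _ sub_res sub_res_morph.

Definition sub_hom : {grouphom subgroup_of S -> subgroup_of T} := sub_res.

Definition quot_res (c : lcoset_of S) : lcoset_of T :=
  lcoset_class T (f (lcoset_repr c)).

Lemma quot_resE x : quot_res (lcoset_class S x) = lcoset_class T (f x).
Proof.
apply/lcoset_classP; rewrite -gmulfV -gmulfM; apply: fST.
by apply/lcoset_classP; rewrite lcoset_reprK.
Qed.

End SubgroupHom.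

Record subsheaf (X : ograph) (F : group_sheaf X) := Subsheaf {
  vsub : forall v, groupClosed (vstalk F v);
  esub : forall e, groupClosed (estalk F e);
  sub_tail : forall e,
    {homo res_tail F e : x / x \in vsub (tail e) >-> x \in esub e};
  sub_head : forall e,
    {homo res_head F e : x / x \in vsub (head e) >-> x \in esub e} }.

Section Connecting.
Variables (X : ograph) (F : group_sheaf X) (S : subsheaf F).

Definition sheaf_of_sub : group_sheaf X :=
  @GroupSheaf X (fun v => subgroup_of (vsub S v))
    (fun e => subgroup_of (esub S e))
    (fun e => sub_hom (@sub_tail _ _ S e))
    (fun e => sub_hom (@sub_head _ _ S e)).

Definition quotient_sheaf : set_sheaf X :=
  @SetSheaf X (fun v => lcoset_of (vsub S v))
    (fun e => lcoset_of (esub S e))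
    (fun e => @quot_res _ _ (res_tail F e) _ _)
    (fun e => @quot_res _ _ (res_head F e) _ _).

Definition coboundary_in_sub (xi : forall v, vstalk F v) : Prop :=
  forall e, (res_tail F e (xi (tail e)))^-1 * res_head F e (xi (head e))
            \in esub S e.

Definition lift_cochain (xi : forall v, vstalk F v)
    (xiS : coboundary_in_sub xi) : cochain1 sheaf_of_sub :=
  [ffun e => SubgroupOf (xiS e)].

Lemma section_reprS (s : H0 quotient_sheaf) :
  coboundary_in_sub (fun v => lcoset_repr (val s v)).
Proof. by move=> e; apply/lcoset_classP/eqP/(forallP (valP s)). Qed.

(* The connecting map, computed with the canonical representatives as lift;
   [connectingE] shows that every lift gives the same class. *)
Definition connecting (s : H0 quotient_sheaf) : H1 sheaf_of_sub :=
  H1_class (lift_cochain (section_reprS s)).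

Lemma section_liftS (s : H0 quotient_sheaf) (xi : forall v, vstalk F v) :
  (forall v, lcoset_class (vsub S v) (xi v) = val s v) -> coboundary_in_sub xi.
Proof.
move=> xis e; apply/lcoset_classP.
rewrite -(quot_resE (@sub_tail _ _ S e)) -(quot_resE (@sub_head _ _ S e)) !xis.
exact/eqP/(forallP (valP s)).
Qed.

Lemma connectingE (s : H0 quotient_sheaf) (xi : forall v, vstalk F v)
    (xis : forall v, lcoset_class (vsub S v) (xi v) = val s v) :
  connecting s = H1_class (lift_cochain (section_liftS xis)).
Proof.
have zS v : (lcoset_repr (val s v))^-1 * xi v \in vsub S v.
  by apply/lcoset_classP; rewrite lcoset_reprK xis.
apply/H1_classP; exists (fun v => SubgroupOf (zS v)) => e.
apply: val_inj; rewrite /= !ffunE /= !gmulfM !gmulfV invgM invgK !mulgA.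
by rewrite !mulgK.
Qed.

End Connecting.

Definition constant_sheaf (X : ograph) (G : groupType) : group_sheaf X :=
  @GroupSheaf X (fun=> G) (fun=> G) (fun=> idfun) (fun=> idfun).

Section RelativeSubsheaf.
Variables (G : groupType) (X : ograph) (A : {set vert X}).

Definition vrel (v : vert X) : {pred G} := fun x => (v \in A) ==> (x == 1).

Lemma in_vrel v x : (x \in vrel v) = ((v \in A) ==> (x == 1)).
Proof. by []. Qed.

Fact vrel_closed v : group_closed (vrel v).
Proof.
split=> [|x y]; rewrite !in_vrel ?eqxx ?implybT //.
by case: (v \in A) => //= /eqP-> /eqP->; rewrite divg1.
Qed.

HB.instance Definition _ v :=
  isMulClosed.Build G (vrel v) (group_closedM (vrel_closed v)).
HB.instance Definition _ v :=
  isMul1Closed.Build G (vrel v) (fst (vrel_closed v)).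
HB.instance Definition _ v :=
  isInvClosed.Build G (vrel v) (group_closedV (vrel_closed v)).

Definition allG : {pred G} := predT.

HB.instance Definition _ := isMulClosed.Build G allG (fun _ _ _ _ => isT).
HB.instance Definition _ := isMul1Closed.Build G allG isT.
HB.instance Definition _ := isInvClosed.Build G allG (fun _ _ => isT).

(* The subsheaf [G_A] of the constant sheaf: trivial on the vertices of [A],
   everything elsewhere. *)
Definition relative_subsheaf : subsheaf (constant_sheaf X G) :=
  @Subsheaf X (constant_sheaf X G) (fun v => vrel v) (fun=> allG)
    (fun _ _ _ => isT) (fun _ _ _ => isT).

Definition relative_sheaf : group_sheaf X := sheaf_of_sub relative_subsheaf.

Definition relative_quotient : set_sheaf X :=
  quotient_sheaf relative_subsheaf.

Definition family_values (xi : vert X -> G) :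
    {dffun forall v, svstalk relative_quotient v} :=
  [ffun v => lcoset_class (vrel v) (xi v)].

Fact family_values_subproof (xi : vert X -> G) :
  [forall e, sres_tail relative_quotient e (family_values xi (tail e))
             == sres_head relative_quotient e (family_values xi (head e))].
Proof. by apply/forallP=> e; apply/eqP/lcoset_classP. Qed.

Definition family_section (xi : vert X -> G) : H0 relative_quotient :=
  exist _ (family_values xi) (family_values_subproof xi).

Lemma family_section_eq (xi zeta : vert X -> G) :
  {in A, xi =1 zeta} -> family_section xi = family_section zeta.
Proof.
move=> eqA; apply: val_inj; apply/ffunP => v; rewrite !ffunE.
apply/lcoset_classP; rewrite in_vrel; apply/implyP => /eqA->.
by rewrite mulVg.
Qed.

Definition difference_cochain (xi : vert X -> G) : cochain1 relative_sheaf :=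
  [ffun e => SubgroupOf (isT : (xi (tail e))^-1 * xi (head e) \in allG)].

Lemma connecting_family (xi : vert X -> G) :
  connecting (family_section xi) = H1_class (difference_cochain xi).
Proof.
have xis v : lcoset_class (vsub relative_subsheaf v) (xi v)
             = val (family_section xi) v by rewrite /= ffunE.
rewrite (connectingE xis); congr H1_class; apply/ffunP => e; apply: val_inj.
by rewrite !ffunE.
Qed.

End RelativeSubsheaf.

Section Path.
Variable n : nat.

Fact path_hi_subproof (i : 'I_n.-1) : i.+1 < n.
Proof. by rewrite -ltn_predRL. Qed.

Definition path_lo (i : 'I_n.-1) : 'I_n := widen_ord (leq_pred n) i.
Definition path_hi (i : 'I_n.-1) : 'I_n := Ordinal (path_hi_subproof i).

(* The path on vertices 0, ..., n - 1, with an arbitrary orientation: edge [i]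
   joins [i] and [i + 1] and points to [i + 1] iff [o i]. *)
Definition path_graph (o : 'I_n.-1 -> bool) : ograph :=
  @OGraph 'I_n 'I_n.-1
    (fun i => if o i then path_lo i else path_hi i)
    (fun i => if o i then path_hi i else path_lo i).

Hypothesis hn : 1 < n.

Fact path_last_subproof : n.-1 < n.
Proof. by rewrite ltn_predL ltnW. Qed.

Definition path_first : 'I_n := Ordinal (ltnW hn).
Definition path_last : 'I_n := Ordinal path_last_subproof.

Definition endpoints : {set 'I_n} := [set path_first; path_last].

Variables (G : groupType) (o : 'I_n.-1 -> bool).

Definition path_sheaf : group_sheaf (path_graph o) :=
  @relative_sheaf G (path_graph o) endpoints.

Definition path_quotient : set_sheaf (path_graph o) :=
  @relative_quotient G (path_graph o) endpoints.

Definition path_delta : H0 path_quotient -> H1 path_sheaf :=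
  @connecting _ _ (@relative_subsheaf G (path_graph o) endpoints).

(* The identification G x G -> H^0(X; Q), see [boundary_data_bij]; the value
   at the interior vertices is irrelevant. *)
Definition boundary_data (b : G * G) : H0 path_quotient :=
  @family_section G (path_graph o) endpoints
    (fun v => if v == path_first then b.1
              else if v == path_last then b.2 else 1).

Lemma boundary_data_bij : bijective boundary_data.
Proof.
have neq : path_last == path_first = false.
  by apply/eqP => /(congr1 val) /=; case: (n) hn => [|[]].
pose ev (s : H0 path_quotient) (v : 'I_n) : G := lcoset_repr (val s v).
exists (fun s => (ev s path_first, ev s path_last)) => [[g0 g1]|s].
  have evE xi (v : 'I_n) : v \in endpoints ->
      ev (@family_section G (path_graph o) endpoints xi) v = xi v.
    move=> vA; rewrite /ev /= ffunE; apply/esym/eqP.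
    have /lcoset_classP := lcoset_reprK
      (lcoset_class (@vrel G (path_graph o) endpoints v) (xi v)).
    by rewrite in_vrel vA /= mulg_eq1 eqg_inv eq_sym.
  by rewrite /= /boundary_data !evE ?inE ?eqxx ?orbT //= neq.
apply: val_inj; apply/ffunP => v; rewrite /= ffunE.
rewrite -[RHS]lcoset_reprK; apply/lcoset_classP.
rewrite in_vrel !inE.
case: eqP => [->|_] /=; first by rewrite mulVg.
by case: eqP => [->|_] //=; rewrite mulVg.
Qed.

End Path.

(* Main.v *)
From mathcomp Require Import all_boot.
Require Import Defs.

(** A family [xi] on the vertices represents a class [delta^* beta], and this
    class is distinguished exactly when the values of [xi] on [A] extend to a
    global section of the constant sheaf ([connecting_family_one]): a
    trivializing 0-cochain [zeta] of the relative sheaf equals 1 on [A], and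
    the product [xi * zeta] has equal values at the two ends of every edge;
    conversely, a global section is a lift of [beta] with trivial coboundary.
    Since a path is connected, its global sections are the constant families
    ([path_section_const]), and a constant family with prescribed endpoint
    values [g0] and [g1] exists if and only if [g0 = g1]. *)

Set Implicit Arguments.
Unset Strict Implicit.
Unset Printing Implicit Defensive.

Local Open Scope group_scope.

(** Exactness at [H^0(X; Q)]: the connecting map kills precisely the sections
    that come from global sections of the constant sheaf. *)
Lemma connecting_family_one (G : groupType) (X : ograph) (A : {set vert X})
    (xi : vert X -> G) :
  connecting (family_section A xi) = H1_one (relative_sheaf G A) <->
  exists2 zeta : vert X -> G,
    {in A, xi =1 zeta} & forall e, zeta (tail e) = zeta (head e).
Proof.
split=> [|[zeta xiA zetaE]].
  rewrite connecting_family => /H1_classP[zeta zetaE].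
  exists (fun v => xi v * sgval (zeta v)) => [v vA|e].
    by have := valP (zeta v); rewrite in_vrel vA => /eqP /= ->; rewrite mulg1.
  have /(congr1 (@sgval _ _)) := zetaE e.
  rewrite !ffunE /= => /esym/eqP.
  by rewrite -!mulgA mulgA -invgM mulg_eq1 eqg_inv => /eqP.
rewrite (family_section_eq xiA) connecting_family /H1_one; congr H1_class.
apply/ffunP => e; apply: val_inj.
by rewrite !ffunE /= zetaE mulVg.
Qed.

Lemma path_section_const (T : Type) (n : nat) (o : 'I_n.-1 -> bool)
    (f : 'I_n -> T) :
  (forall e : edge (path_graph o), f (tail e) = f (head e)) ->
  forall i j, f i = f j.
Proof.
move=> fE.
have step (i : 'I_n.-1) : f (path_lo i) = f (path_hi i).
  by have := fE i; rewrite /=; case: (o i).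
case: n => [|n] in o f fE step *; first by case.
suff f0 (i : 'I_n.+1) : f i = f ord0 by move=> i j; rewrite !f0.
case: i; elim=> [|k IHk] ltk; first by congr f; apply: val_inj.
rewrite -(IHk (ltnW ltk)).
by transitivity (f (path_hi (Ordinal (ltk : k < n.+1.-1))));
  [congr f | rewrite -step; congr f]; apply: val_inj.
Qed.

Theorem mainTheorem2 (G : groupType) (n : nat) (hn : 1 < n)
  (o : 'I_n.-1 -> bool) (g0 g1 : G) :
  (path_delta (boundary_data hn o (g0, g1)) = H1_one (path_sheaf hn G o)
     <-> g0 = g1)
  /\ (g0 <> g1 ->
      path_delta (boundary_data hn o (g0, g1)) <> H1_one (path_sheaf hn G o)).
Proof.
suff deltaP : path_delta (boundary_data hn o (g0, g1))
    = H1_one (path_sheaf hn G o) <-> g0 = g1.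
  by split=> // neq_g /deltaP.
have neq : path_last hn == path_first hn = false.
  by rewrite -val_eqE /=; case: n hn {o} => [|[]].
apply: iff_trans (connecting_family_one _ _) _.
split=> [[zeta zetaA zetaE]|<-].
  have := zetaA (path_first hn); rewrite !inE eqxx => /(_ isT) /= ->.
  have := zetaA (path_last hn); rewrite !inE eqxx orbT neq => /(_ isT) /= ->.
  exact: path_section_const zetaE _ _.
exists (fun=> g0) => // v; rewrite !inE.
by case: (v == path_first hn) => //= ->.
Qed.
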